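(* (a) Every Hausdorff topological group that is locally pseudocompact and totally disconnected admits a coarser (Hausdorff) zero-dimensional group topology. (b) Every Hausdorff topological group that is minimal, locally pseudocompact, and totally disconnected is zero-dimensional, and thus strongly Vedenissoff.
   Context: All topological groups are assumed to be Hausdorff (hence Tychonoff), and are not necessarily abelian. A ''neighborhood'' of a point is an open set containing it. ''Coarser'' allows equality. A Tychonoff space is zero-dimensional if it has a base consisting of clopen (open-and-closed) sets. A Tychonoff space $X$ is pseudocompact if every continuous real-valued map on $X$ is bounded. A topological group $G$ is locally pseudocompact if there is a neighborhood $U$ of the identity such that $\operatorname{cl}_G U$ is pseudocompact. A space is totally disconnected if its quasi-components are singletons (the quasi-component of a point is the intersection of all clopen sets containing it). A (Hausdorff) topological group $G$ is minimal if there is no strictly coarser Hausdorff group topology on $G$. For a topological group $G$: $G_0$ is the connected component of the identity; $z(G)$ is the intersection of all kernels of continuous homomorphisms from $G$ into zero-dimensional topological groups; $o(G)$ is the intersection of all open subgroups of $G$. $G$ is Vedenissoff if $G/G_0$ is zero-dimensional; it is strongly Vedenissoff if in addition $z(G)=o(G)$. *)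

(* Defs.v *)
From HB Require Import structures.
From mathcomp Require Import all_boot all_order all_algebra generic_quotient.
From mathcomp Require Import all_classical all_reals all_analysis.
Import numFieldNormedType.Exports.

Set Implicit Arguments.
Unset Strict Implicit.
Unset Printing Implicit Defensive.

Local Open Scope classical_set_scope.
Local Open Scope group_scope.
Local Open Scope quotient_scope.

HB.structure Definition PreTopologicalGroup :=
  {G of Topological G & Group G}.

HB.mixin Record PreTopologicalGroup_isTopologicalGroup G
    & PreTopologicalGroup G := {
  mulg_continuous : continuous (fun x : G * G => x.1 * x.2) ;
  invg_continuous : continuous (fun x : G => x^-1)
}.

#[short(type="topGroupType")]
HB.structure Definition TopologicalGroup :=
  {G of PreTopologicalGroup G & PreTopologicalGroup_isTopologicalGroup G}.

Definition tychonoff_space (X : topologicalType) : Prop :=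
  hausdorff_space X /\ completely_regular_space X.

(* Stronger than [zero_dimensional] of mathcomp-analysis, which only asks that
   distinct points be separated by clopen sets. *)
Definition zerodim_space (X : topologicalType) : Prop :=
  tychonoff_space X /\ exists B : set_system X, basis B /\ B `<=` clopen.

Definition quasi_component (X : topologicalType) (x : X) : set X :=
  \bigcap_(C in [set C : set X | clopen C /\ C x]) C.

(* Stronger than [totally_disconnected] of mathcomp-analysis, which is about
   connected components instead of quasi-components. *)
Definition totdisc_space (X : topologicalType) : Prop :=
  forall x : X, quasi_component x = [set x].

Definition pseudocompact (R : realType) (X : topologicalType) : Prop :=
  forall f : X -> R, continuous f -> bounded_fun f.

(* [closure U] is coerced to the subtype [set_type (closure U)], which carries
   the induced topology. *)
Definition locally_pseudocompact (R : realType) (G : topGroupType) : Prop :=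
  exists U : set G, open_nbhs 1 U /\ pseudocompact R (closure U).

Record topology_on (T : choiceType) := TopologyOn {
  topology_open :> set_system T ;
  topology_openT : topology_open setT ;
  topology_openI : setI_closed topology_open ;
  topology_open_bigcup : forall (I : Type) (f : I -> set T),
    (forall i, topology_open (f i)) -> topology_open (\bigcup_i f i)
}.

(* A copy of [T] whose topology is [tau], whatever the topology of [T]. *)
Definition retopologize (T : choiceType) (tau : topology_on T) : Type := T.

HB.instance Definition _ (T : choiceType) (tau : topology_on T) :=
  Choice.copy (retopologize tau) T.
HB.instance Definition _ (T : choiceType) (tau : topology_on T) :=
  isOpenTopological.Build (retopologize tau)
    (topology_openT tau) (@topology_openI _ tau) (@topology_open_bigcup _ tau).
HB.instance Definition _ (G : groupType) (tau : topology_on G) :=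
  Group.copy (retopologize tau) G.

Definition group_topology (G : groupType) (tau : topology_on G) : Prop :=
  continuous (fun x : retopologize tau * retopologize tau => x.1 * x.2) /\
  continuous (fun x : retopologize tau => x^-1).

Definition minimal_group (G : topGroupType) : Prop :=
  ~ exists tau : topology_on G,
    [/\ group_topology tau, hausdorff_space (retopologize tau)
      & tau `<` @open G].

Definition component1 (G : topGroupType) : set G :=
  connected_component setT 1.
Arguments component1 : clear implicits.

Section component_quotient.
Variable G : topGroupType.

Lemma mulg_continuousl (x : G) : continuous (fun y : G => x * y).
Proof.
move=> y; apply: (@continuous_comp _ _ _ (fun y : G => (x, y))
  (fun z : G * G => z.1 * z.2)); last exact: mulg_continuous.
by apply: cvg_pair => /=; [exact: cvg_cst|exact: cvg_id].
Qed.

Lemma component1_divl (x y : G) :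
  component1 G x -> component1 G y -> component1 G (x^-1 * y).
Proof.
move=> Gx Gy.
exists [set x^-1 * z | z in component1 G]; last by exists y.
split=> //; first by exists x => //; rewrite mulVg.
apply: connected_continuous_connected; first exact: component_connected.
by apply: continuous_subspaceT; exact: mulg_continuousl.
Qed.

Lemma component1_1 : component1 G 1.
Proof. exact: connected_component_refl. Qed.

Definition component1_rel : rel G := fun x y => `[< component1 G (x^-1 * y) >].

Lemma component1_rel_refl : reflexive component1_rel.
Proof. by move=> x; apply/asboolP; rewrite mulVg; exact: component1_1. Qed.

Lemma component1_rel_sym : symmetric component1_rel.
Proof.
suff H x y : component1_rel x y -> component1_rel y x.
  by move=> x y; apply/idP/idP; exact: H.
move=> /asboolP xy; apply/asboolP.
by have := component1_divl xy component1_1; rewrite mulg1 invgM invgK.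
Qed.

Lemma component1_rel_trans : transitive component1_rel.
Proof.
move=> y x z; rewrite [component1_rel x y]component1_rel_sym.
move=> /asboolP yx /asboolP yz; apply/asboolP.
by have := component1_divl yx yz; rewrite invgM invgK -mulgA mulVKg.
Qed.

Definition component1_equiv :=
  EquivRel component1_rel component1_rel_refl component1_rel_sym
    component1_rel_trans.

(* G / G_0 as a space of left cosets; zero-dimensionality does not involve the
   group structure, which is therefore not built. *)
Definition component_quotient : Type :=
  quotient_topology {eq_quot component1_equiv}.

HB.instance Definition _ := Topological.on component_quotient.

End component_quotient.

Definition zerodim_kernel (G : topGroupType) : set G :=
  [set x | forall (H : topGroupType) (f : {multiplicative G -> H}),
    zerodim_space H -> continuous f -> f x = 1].
Arguments zerodim_kernel : clear implicits.

Definition open_subgroup (G : topGroupType) (K : set G) : Prop :=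
  open K /\ group_closed [in K].

Definition open_core (G : topGroupType) : set G :=
  \bigcap_(K in @open_subgroup G) K.
Arguments open_core : clear implicits.

Definition vedenissoff (G : topGroupType) : Prop :=
  zerodim_space (component_quotient G).

Definition strongly_vedenissoff (G : topGroupType) : Prop :=
  vedenissoff G /\ zerodim_kernel G = open_core G.

(* Main.v *)
From HB Require Import structures.
Require Import Defs.
From mathcomp Require Import all_boot all_order all_algebra generic_quotient.
From mathcomp Require Import all_classical all_reals all_analysis.
Import GRing.Theory Num.Theory Order.TTheory.
Import numFieldNormedType.Exports.

Set Implicit Arguments.
Unset Strict Implicit.
Unset Printing Implicit Defensive.

Local Open Scope classical_set_scope.
Local Open Scope group_scope.
Local Open Scope quotient_scope.

(** A locally pseudocompact group [G] is dense in its completion, which is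
    locally compact, and its clopen subsets are traces of clopen subsets of the
    completion.  In a locally compact group the quasi-component of 1 is the
    intersection of the open subgroups.  Hence the open subgroups of [G]
    intersect in the quasi-component of 1, which is trivial when [G] is totally
    disconnected ([locally_pseudocompact_open_subgroup]).  The left cosets of
    open subgroups then form a base of clopen sets for a coarser Hausdorff group
    topology ([coset_topology]), which is (a).  If [G] is minimal, this is the
    topology of [G]; so [G] is zero-dimensional, [G / G_0] is [G] itself, and
    both [z(G)] and [o(G)] are trivial, which is (b).

    To separate 1 from [x] by an open subgroup, the completion is replaced by a
    coarser, first countable topology on [G] that depends on a clopen set [C]
    containing 1 but not [x].

    - A set [U] with pseudocompact closure is feebly compact: translates
      [x_n V_n] of neighbourhoods of 1, with [x_n] in [U], accumulate somewhere
      ([pseudocompact_feebly_compact]).  The rest of the proof uses only this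
      property of [U].

    - Every clopen set [C] is uniformly clopen on a smaller neighbourhood [A] of
      1: some neighbourhood [V] of 1 satisfies [(C `&` A) V `<=` C]
      ([clopen_uniform]).  This says that the closures of [C] and of its
      complement in the completion do not meet near 1.

    - A sequence [V_0, V_1, ...] of neighbourhoods of 1, chosen small enough,
      defines a coarser topology in which [C], cut down to the open subgroup
      generated by [A], is still clopen.  Feeble compactness turns into
      compactness for this topology ([shrinking_compact]).

    - In this locally compact setting, an argument in the style of van Dantzig,
      carried out modulo the quasi-component [Q] of 1, yields a set [E] that
      contains 1 but not [x] and satisfies [E V `<=` E] for a neighbourhood [V]
      of 1 ([locally_compact_clopen_invariant]).  The [h] with [E h = E] form
      the open subgroup that is sought ([open_subgroup_separates]). *)

(** * Clopen sets in a locally compact group *)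

Lemma clopen_nbhs (T : topologicalType) (C : set T) :
  (forall x, C x -> nbhs x C) -> (forall x, ~ C x -> nbhs x (~` C)) -> clopen C.
Proof.
move=> CC CN; split; first by rewrite openE => x /CC.
by rewrite -openC openE => x /CN.
Qed.

Lemma clopen_in (T : topologicalType) (C : set T) x :
  clopen C -> C x -> nbhs x C.
Proof. by move=> [oC _] Cx; apply: open_nbhs_nbhs. Qed.

Lemma clopen_out (T : topologicalType) (C : set T) x :
  clopen C -> ~ C x -> nbhs x (~` C).
Proof.
by move=> [_ cC] Cx; apply: open_nbhs_nbhs; split=> //; rewrite openC.
Qed.

(** Compactness as it is used below: if no single member of a downward directed
    family avoids [K], then some point of [K] is adherent to all members. *)
Lemma compact_directed (T : topologicalType) (K : set T) (I : Type) (D : set I)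
    (B : I -> set T) : compact K -> D !=set0 ->
  (forall i j, D i -> D j -> exists2 k, D k & B k `<=` B i `&` B j) ->
  (forall i, D i -> K `&` B i !=set0) ->
  exists2 p, K p & forall i, D i -> closure (B i) p.
Proof.
move=> cK [i0 Di0] dir KB.
pose F := filter_from D (fun i => K `&` B i).
have PF : ProperFilter F.
  apply: filter_from_proper => //; apply: filter_from_filter.
    by exists i0.
  move=> i j Di Dj; have [k Dk kij] := dir i j Di Dj.
  by exists k => // z [Kz /kij[]].
have [|p [Kp clp]] := cK F PF; first by exists i0 => // z [].
exists p => // i Di A pA; have [|z [[_ Bz] Az]] := clp (K `&` B i) A _ pA.
  by exists i.
by exists z.
Qed.

(** In the first countable topologies introduced below, right translations need
    not be continuous: only those by elements of an open set are.  This section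
    therefore assumes continuity of left translations, of right translations by
    elements of a neighbourhood [U] of 1, and of multiplication at (1, 1). *)
Section left_topological_group.
Variable G : PreTopologicalGroup.type.
Hypothesis mull_cont : forall (g x : G) (A : set G),
  nbhs (g * x) A -> nbhs x [set y | A (g * y)].

Definition right_cont (h : G) := forall (x : G) (A : set G),
  nbhs (x * h) A -> nbhs x [set y | A (y * h)].

Lemma right_contM (h k : G) :
  right_cont h -> right_cont k -> right_cont (h * k).
Proof.
move=> hh hk x A; rewrite mulgA => /hk /hh.
by apply: filterS => y /=; rewrite mulgA.
Qed.

Lemma nbhs_left (g : G) (A : set G) : nbhs 1 A -> nbhs g [set y | A (g^-1 * y)].
Proof. by move=> A1; apply: (@mull_cont g^-1 g A); rewrite mulVg. Qed.

Lemma nbhs_left1 (g : G) (A : set G) : nbhs g A -> nbhs 1 [set y | A (g * y)].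
Proof. by move=> Ag; apply: (@mull_cont g 1 A); rewrite mulg1. Qed.

Lemma clopen_shift (g : G) (C : set G) :
  clopen C -> clopen [set x | C (g * x)].
Proof.
move=> cC; apply: clopen_nbhs => x h.
- exact: (mull_cont (clopen_in cC h)).
- exact: (mull_cont (clopen_out cC h)).
Qed.

Lemma clopen_shiftr (h : G) (C : set G) :
  right_cont h -> clopen C -> clopen [set x | C (x * h)].
Proof.
move=> rh cC; apply: clopen_nbhs => x xh.
- exact: (rh _ _ (clopen_in cC xh)).
- exact: (rh _ _ (clopen_out cC xh)).
Qed.

Local Notation Q := (quasi_component (1 : G)).

Lemma quasi1 : Q 1. Proof. by move=> C []. Qed.

(** Since [c^-1 C] is a clopen set containing 1, it contains [Q]: clopen sets
    are unions of left cosets of [Q].  In particular [Q] is a subgroup. *)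
Lemma clopen_quasi (C : set G) c q : clopen C -> Q q -> C c -> C (c * q).
Proof.
move=> cC Qq Cc; apply: (Qq [set x | C (c * x)]); split.
  exact: clopen_shift.
by rewrite /= mulg1.
Qed.

Lemma quasiM a b : Q a -> Q b -> Q (a * b).
Proof.
move=> Qa Qb C CC; apply: clopen_quasi => //; [by case: CC|exact: Qa].
Qed.

Lemma quasiV a : Q a -> Q a^-1.
Proof.
move=> Qa C [cC C1]; apply: contrapT => CN.
have : (~` C) (a^-1 * a) by apply: (clopen_quasi (clopenC setT cC)).
by rewrite mulVg.
Qed.

Lemma quasiJ h a : right_cont h -> Q a -> Q (h^-1 * a * h).
Proof.
move=> rh Qa C [cC C1].
apply: (Qa [set x | C (h^-1 * x * h)]); split; last by rewrite /= mulg1 mulVg.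
apply: (@clopen_shift h^-1 [set x | C (x * h)]); exact: clopen_shiftr.
Qed.

Hypothesis mul_cont1 : forall A : set G, nbhs 1 A ->
  exists2 B : set G, nbhs 1 B & forall a b, B a -> B b -> A (a * b).
Variable U : set G.
Hypothesis U1 : nbhs 1 U.
Hypothesis UV : forall u, U u -> U u^-1.
Hypothesis UR : forall u, U u -> right_cont u.

Let P := [set h | right_cont h /\ right_cont h^-1].

(** [P] is a subgroup containing a neighbourhood of 1, so it is a union of left
    cosets that are neighbourhoods of their points, as is its complement. *)
Let clopen_P : clopen P.
Proof.
have UP u : U u -> P u by move=> Uu; split; apply: UR => //; exact: UV.
have PM a b : P a -> P b -> P (a * b).
  by move=> [a1 a2] [b1 b2]; split; rewrite ?invgM; exact: right_contM.
apply: clopen_nbhs => x Px; apply: filterS (nbhs_left x U1) => y /= /UP Uy.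
  by have := PM _ _ Px Uy; rewrite mulVKg.
move=> Py; apply: Px.
have /(PM _ _ Py) : P (x^-1 * y)^-1.
  by case: Uy => a b; split=> //; rewrite invgK.
by rewrite invgM invgK mulVKg.
Qed.

(** [Q] lies in every clopen set containing 1, in particular in [P]. *)
Let quasi_rc q : Q q -> right_cont q.
Proof.
move=> Qq; suff [] : P q by [].
apply: Qq; split=> //.
by split; rewrite ?invg1 => x A; rewrite mulg1; apply: filterS => y /=;
  rewrite mulg1.
Qed.

Variables (K W S : set G).
Hypothesis compactK : compact K.
Hypothesis W1 : nbhs 1 W.
Hypothesis S1 : nbhs 1 S.
Hypothesis SU : S `<=` U.
Hypothesis WSK : forall w s, W w -> S s -> K (w * s^-1).

(** Van Dantzig's argument modulo [Q].  When [Q] is trivial, compactness of [K]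
    gives a clopen neighbourhood [C] of 1 inside [K], and then a neighbourhood
    [V] of 1 with [C V `<=` C], again by compactness.  In general the interior
    of [W] is replaced by its saturation [O Q], which is not contained in a
    compact set; but [C] is [Q]-invariant and the elements near 1 normalize [Q],
    so that every question about [C] reduces to its points in [K]. *)
Theorem locally_compact_clopen_invariant (E : set G) x :
  clopen E -> E 1 -> ~ E x ->
  exists C V : set G, [/\ C 1, ~ C x, nbhs 1 V &
    forall c v, C c -> V v -> C (c * v)].
Proof.
move=> cE E1 Ex.
pose O := W°.
have oO : open O by exact: open_interior.
have O1 : O 1 by [].
have OW : O `<=` W by exact: interior_subset.
pose OQ := [set y | exists2 q, Q q & O (y * q)].
have oOQ : open OQ.
  rewrite openE => y [q Qq Oy]; rewrite /interior.
  have /quasi_rc/(_ y O) := Qq.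
  move=> /(_ (open_nbhs_nbhs (conj oO Oy))).
  by apply: filterS => z /= Oz; exists q.
have OQ1 : OQ 1 by exists 1; [exact: quasi1|rewrite mulg1].
have OQQ y q : OQ y -> Q q -> OQ (y * q).
  move=> [r Qr Or] Qq; exists (q^-1 * r); last by rewrite mulgA mulgK.
  by apply: quasiM => //; exact: quasiV.
(* [K \ O Q] is compact and misses [Q], an intersection of clopen sets. *)
have [C0 [cC0 C01] C0B] : exists2 C, clopen C /\ C 1 & C `&` K `<=` OQ.
  apply: contrapT => /forall2NP H.
  have [||||p [Kp Op] clp] := @compact_directed _ (K `\` OQ) _
      [set C : set G | clopen C /\ C 1] id.
  - by rewrite setDE; apply: compact_closedI => //; rewrite closedC.
  - by exists setT; split=> //; exact: clopenT.
  - move=> A B [cA A1] [cB B1]; exists (A `&` B) => //.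
    by split=> //; exact: clopenI.
  - move=> C DC; apply: contrapT => CK; have [//|] := H C; apply.
    by move=> z [Cz Kz]; apply: contrapT => Oz; apply: CK; exists z.
  apply: Op; exists p^-1; last by rewrite mulgV.
  apply: quasiV => C CC; have [_ cC] := CC.1; apply: cC; exact: (clp C CC).
pose C := C0 `&` E `&` OQ.
have cC0E : clopen (C0 `&` E) by exact: clopenI.
have CQ y q : C y -> Q q -> C (y * q).
  move=> [y1 y2] Qq; split; last exact: OQQ.
  exact: clopen_quasi.
(* If [y] adheres to [C], then [y s = w q] for some [w] in [O], [q] in [Q] and
   [s] near 1.  As [s] normalizes [Q], [y] is congruent modulo [Q] to [w s^-1],
   which is in [C0] and in [K], hence in [O Q]. *)
have cC : clopen C.
  split; first by apply: openI => //; case: cC0E.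
  move=> y cly.
  have yC0E : (C0 `&` E) y.
    by case: cC0E => _; apply; apply: closureS cly => z [].
  have [z [[_ [q Qq Ozq]] Syz]] := cly _ (nbhs_left y S1).
  set s := y^-1 * z in Syz.
  have rs : right_cont s^-1 by apply: UR; apply: UV; exact: SU.
  have Qsq : Q (s * q * s^-1) by rewrite -{1}[s]invgK; exact: quasiJ.
  have yE : y * (s * q * s^-1) = z * q * s^-1 by rewrite /s !mulgA mulgV mul1g.
  have yOQ : OQ (y * (s * q * s^-1)).
    apply: C0B; split; first by apply: clopen_quasi => //; case: yC0E.
    by rewrite yE; apply: WSK => //; exact: OW.
  split=> //.
  have := OQQ _ _ yOQ (quasiV Qsq).
  by rewrite mulgK.
(* Otherwise the points of [C `&` K] that a small element moves out of [C] would
   accumulate at a point of [C], which is open. *)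
have [V V1 CV] : exists2 V, nbhs 1 V &
    forall c v, C c -> K c -> V v -> C (c * v).
  apply: contrapT => /forall2NP H.
  have [||||p [Kp Cp] clp] := @compact_directed _ (K `&` C) _
      [set V : set G | nbhs 1 V]
      (fun V => [set c | exists2 v, V v & ~ C (c * v)]).
  - by apply: compact_closedI => //; case: cC.
  - by exists setT; exact: filterT.
  - move=> A B A1 B1; exists (A `&` B); first exact: filterI.
    by move=> c [v [Av Bv] ?]; split; exists v.
  - move=> V V1; apply: contrapT => KV.
    have [//|] := H V; apply => c v Cc Kc Vv; apply: contrapT => nC.
    by apply: KV; exists c; split=> //; exists v.
  have [B B1 BC] := mul_cont1 (nbhs_left1 (clopen_in cC Cp)).
  have [c [[v Bv nC] Bc]] := clp B B1 _ (nbhs_left p B1).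
  by apply: nC; have := BC _ _ Bc Bv; rewrite /= !mulgA mulgV mul1g.
exists C, (V `&` U); split => //.
- by move=> [[]].
- exact: filterI.
move=> c v Cc [Vv Uv].
(* Replace [c] by the congruent element [c q], which is in [O] and so in [K]. *)
have [q Qq Ocq] := Cc.2.
have -> : c * v = c * q * v * (v^-1 * q^-1 * v).
  by rewrite !mulgA mulgK mulgK.
apply: (CQ _ _ _); last by apply: quasiJ; [exact: UR|exact: quasiV].
apply: CV => //; first exact: CQ.
rewrite -[c * q]mulg1 -invg1; apply: WSK; first exact: OW.
exact: nbhs_singleton S1.
Qed.
End left_topological_group.

(** * Feebly compact subsets of topological groups *)

Section topological_group.
Variable G : topGroupType.

Lemma nbhs_mul (x y : G) (A : set G) : nbhs (x * y) A ->
  exists B C : set G, [/\ nbhs x B, nbhs y C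
    & forall b c, B b -> C c -> A (b * c)].
Proof.
move=> Axy; have [[B C] /= [Bx Cy] BC] := @mulg_continuous G (x, y) A Axy.
by exists B, C; split=> // b c Bb Cc; exact: (BC (b, c)).
Qed.

Lemma nbhs_mull (g x : G) (A : set G) :
  nbhs (g * x) A -> nbhs x [set y | A (g * y)].
Proof.
move=> /nbhs_mul [B [C [Bg Cx BC]]]; apply: filterS Cx => y Cy.
by apply: BC => //; exact: nbhs_singleton Bg.
Qed.

Lemma nbhs_mulr (g x : G) (A : set G) :
  nbhs (x * g) A -> nbhs x [set y | A (y * g)].
Proof.
move=> /nbhs_mul [B [C [Bx Cg BC]]]; apply: filterS Bx => y By.
by apply: BC => //; exact: nbhs_singleton Cg.
Qed.

Lemma nbhs_translate (g : G) (A : set G) :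
  nbhs 1 A -> nbhs g [set y | A (g^-1 * y)].
Proof. exact: (nbhs_left nbhs_mull). Qed.

Lemma nbhs_untranslate (g : G) (A : set G) :
  nbhs g A -> nbhs 1 [set y | A (g * y)].
Proof. exact: (nbhs_left1 nbhs_mull). Qed.

Lemma nbhs_conj (g : G) (A : set G) :
  nbhs 1 A -> nbhs 1 [set y | A (g * y * g^-1)].
Proof.
move=> A1; apply: (@nbhs_mull g 1 [set y | A (y * g^-1)]).
by apply: (@nbhs_mulr g^-1 _ A); rewrite mulg1 mulgV.
Qed.

Lemma nbhs_inv (A : set G) : nbhs 1 A -> nbhs (1 : G) [set y | A y^-1].
Proof. by move=> A1; apply: (@invg_continuous G 1 A); rewrite invg1. Qed.

Definition symmetric_set (A : set G) := forall a, A a -> A a^-1.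

Lemma nbhs_sqrt (A : set G) : nbhs 1 A ->
  exists B : set G, [/\ nbhs 1 B, symmetric_set B, B `<=` A
    & forall a b, B a -> B b -> A (a * b)].
Proof.
move=> A1; have : nbhs (1 * 1 : G) A by rewrite mulg1.
move=> /nbhs_mul [B [C [B1 C1 BC]]].
pose D := B `&` C.
have D1 : nbhs 1 D by exact: filterI.
exists (D `&` [set y | D y^-1]); split.
- by apply: filterI => //; exact: nbhs_inv.
- by move=> a [Da DVa]; split=> //=; rewrite invgK.
- move=> a [[Ba _] _]; rewrite -[a]mulg1; apply: BC => //.
  exact: nbhs_singleton C1.
- by move=> a b [[Ba _] _] [[_ Cb] _]; exact: BC.
Qed.

(** The points [x n * v] must be allowed to move: in a feebly compact space an
    infinite family of open sets accumulates, whereas points chosen in these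
    sets need not. *)
Definition feebly_compact_in (U : set G) :=
  forall (x : nat -> G) (V : nat -> set G),
  (forall n, U (x n)) -> (forall n, nbhs 1 (V n)) ->
  exists p : G, forall A, nbhs p A -> forall N, exists n v,
    [/\ (N <= n)%N, V n v & A (x n * v)].

Definition totally_bounded (U : set G) := forall V, nbhs 1 V ->
  exists F : seq G, forall x, U x -> exists2 f, f \in F & V (f^-1 * x).

(** Otherwise some sequence of points of [U] is [V]-separated, and a small
    translate of a cluster point meets neighbourhoods of two of its terms. *)
Lemma feebly_compact_totally_bounded (U : set G) :
  feebly_compact_in U -> totally_bounded U.
Proof.
move=> cU V V1; apply: contrapT => /forallNP NF.
have /choice[next nextP] : forall F : seq G, exists x, U x /\
    forall f, f \in F -> ~ V (f^-1 * x).
  move=> F; apply: contrapT => /forallNP H; apply: (NF F) => x Ux.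
  apply: contrapT => /forall2NP Hx; apply: (H x); split=> // f fF Vf.
  by have [] := Hx f.
pose Fs := fix Fs n := if n is m.+1 then next (Fs m) :: Fs m else [::].
pose x n := next (Fs n).
have xU n : U (x n) by have [] := nextP (Fs n).
have xF m n : (m < n)%N -> x m \in Fs n.
  elim: n => // n IH; rewrite ltnS leq_eqVlt inE => /orP[/eqP ->|/IH ->].
    by rewrite eqxx.
  by rewrite orbT.
have [B [B1 BV _ BB]] := nbhs_sqrt V1.
have [D [D1 DV _ DD]] := nbhs_sqrt B1.
have [p clp] := cU x (fun=> D) xU (fun=> D1).
have [m [v [_ Dv /= Dpv]]] := clp _ (nbhs_translate p D1) 0%N.
have [n [w [mn Dw /= Dpw]]] := clp _ (nbhs_translate p D1) m.+1.
have [_ /(_ (x m) (xF _ _ mn))] := nextP (Fs n); apply.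
have -> : (x m)^-1 * next (Fs n) =
    (v * (p^-1 * (x m * v))^-1) * ((p^-1 * (x n * w)) * w^-1).
  by rewrite /x !invgM !invgK !mulgA mulgV mul1g !mulgK.
by apply: BB; apply: DD => //; exact: DV.
Qed.

(** Dependent choice for a sequence of neighbourhoods of 1, each small enough
    with respect to the preceding one. *)
Lemma nbhs_sequence (R : nat -> set G -> set G -> Prop) (V0 : set G) :
  nbhs 1 V0 ->
  (forall n V, nbhs 1 V -> exists2 W, nbhs 1 W & R n V W) ->
  exists V : nat -> set G, [/\ V 0%N = V0, forall n, nbhs 1 (V n)
    & forall n, R n (V n) (V n.+1)].
Proof.
move=> V01 step.
have /choice[nxt nxtP] : forall nV : nat * set G, exists W,
    nbhs 1 nV.2 -> nbhs 1 W /\ R nV.1 nV.2 W.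
  move=> [n V]; have [V1|nV] := pselect (nbhs 1 V); last by exists V.
  by have [W W1 RW] := step n V V1; exists W.
pose Vs := fix Vs n := if n is m.+1 then nxt (m, Vs m) else V0.
have V1 n : nbhs 1 (Vs n) by elim: n => //= n IH; have [] := nxtP (n, Vs n) IH.
by exists Vs; split=> // n; have [] := nxtP (n, Vs n) (V1 n).
Qed.

(** Symmetry starts at index 1 so that [V 0] can be any given neighbourhood. *)
Definition shrinking (V : nat -> set G) := [/\ forall n, nbhs 1 (V n),
  forall n, symmetric_set (V n.+1), forall n, V n.+1 `<=` V n
  & forall n a b, V n.+1 a -> V n.+1 b -> V n (a * b)].

Lemma shrinking_le V m n : shrinking V -> (m <= n)%N -> V n `<=` V m.
Proof.
move=> [_ _ VS _]; elim: n => [|n IH]; first by rewrite leqn0 => /eqP ->.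
by rewrite leq_eqVlt => /orP[/eqP -> //|/IH mn]; exact: subset_trans (VS n) mn.
Qed.

(** If the conclusion fails, there are arbitrarily small [v_n] and points [x_n]
    of [U'] with [x_n] in [C] but [x_n v_n] outside.  Choose a shrinking
    sequence [V] with [v_n] in [V n] and such that [C] contains
    [x_n (V n.+1)^2] and misses [x_n v_n (V n.+1)^2].  Let [N] be the
    intersection of the [V n].  The translates [x_n V n.+1] accumulate at some
    [p].  For [nu] in [N] their translates by [nu] stay in [C] and accumulate at
    [p nu], so that [C], being closed, contains [p N].  Along a subsequence for
    which [x_n] tends to [p] modulo [N], the translates [x_n v_n V n.+1]
    accumulate at some [q], which is outside [C]; but [q] is in [p N], because
    the [v_n] tend to 1 modulo [N]. *)
Lemma clopen_uniform (U U' V0 C : set G) : feebly_compact_in U -> nbhs 1 V0 ->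
  (forall u v, U' u -> V0 v -> U (u * v)) -> clopen C ->
  exists2 V, nbhs 1 V & forall g v, U' g -> V v -> C g -> C (g * v).
Proof.
move=> cU V01 U'U cC; apply: contrapT => /forall2NP NV.
have /choice[pick pickP] : forall V : set G, exists gv : G * G, nbhs 1 V ->
    [/\ U' gv.1, V gv.2, C gv.1 & ~ C (gv.1 * gv.2)].
  move=> V; have [V1|] := pselect (nbhs 1 V); last by exists (1, 1).
  apply: contrapT => /forallNP H; have [//|] := NV V; apply => g v U'g Vv Cg.
  by apply: contrapT => nC; apply: (H (g, v)).
pose R (n : nat) (V W : set G) := [/\ symmetric_set W, W `<=` V,
  forall a b, W a -> W b -> V (a * b),
  forall a b, W a -> W b -> C ((pick V).1 * (a * b)) &
  forall a b, W a -> W b -> ~ C ((pick V).1 * (pick V).2 * (a * b))].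
have [|V [VE V1 VR]] := @nbhs_sequence R V0 V01.
  move=> n V V1; have [_ _ Cg Cgv] := pickP V V1.
  have := nbhs_untranslate (clopen_out cC Cgv).
  have := nbhs_untranslate (clopen_in cC Cg).
  move=> /filterI/[apply] /(filterI V1) /nbhs_sqrt[W [W1 Ws WA WW]].
  by exists W => //; split=> // [a /WA[]//|a b Wa Wb|a b Wa Wb|a b Wa Wb];
    have [? []] := WW a b Wa Wb.
have sV : shrinking V by split=> // n; have [] := VR n.
have [_ Vsym VS VV] := sV.
pose x n := (pick (V n)).1; pose v n := (pick (V n)).2.
have U'x n : U' (x n) by have [] := pickP _ (V1 n).
have Vv n : V n (v n) by have [] := pickP _ (V1 n).
have V0v n : V0 (v n) by rewrite -VE; exact: shrinking_le (Vv n).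
have [n|p clp] := cU x (fun n => V n.+1) _ (fun n => V1 n.+1).
  by rewrite -[x n]mulg1; apply: U'U => //; exact: nbhs_singleton V01.
have CN nu : (forall n, V n nu) -> C (p * nu).
  move=> Nnu; apply: contrapT => /(clopen_out cC)/nbhs_mulr/clp/(_ 0%N).
  move=> [n [w [_ Vw]]]; apply; rewrite -mulgA.
  by have [_ _ _ + _] := VR n; apply.
have /choice[s sP] : forall m, exists n, (m <= n)%N /\
    exists2 w, V n.+1 w & V m (p^-1 * (x n * w)).
  move=> m; have [n [w [mn Vw pxw]]] := clp _ (nbhs_translate p (V1 m)) m.
  by exists n; split=> //; exists w.
have [m|q clq] := cU (fun m => x (s m) * v (s m)) (fun m => V (s m).+1) _
  (fun m => V1 (s m).+1).
  exact: U'U.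
have nCq : ~ C q.
  move=> /(clopen_in cC)/clq/(_ 0%N)[m [w [_ Vw]]].
  have [_ _ _ _ +] := VR (s m) => /(_ w 1 Vw (nbhs_singleton (V1 _))).
  by rewrite mulg1.
(* [p^-1 q] is a product of five elements of [V k.+3], hence is in [V k]. *)
apply: nCq; rewrite -[q](mulVKg p); apply: CN => k.
have [m [w [km Vw]]] := clq _ (nbhs_translate q (V1 k.+3)) k.+3.
move=> /=; set b := q^-1 * _ => Vb.
have [msm [w' Vw' /= Va]] := sP m; set a := p^-1 * _ in Va.
have -> : p^-1 * q = ((a * w'^-1) * (v (s m) * w)) * b^-1.
  by rewrite /a /b !invgM !invgK !mulgA !mulgK.
have ksm : (k.+3 <= s m)%N by exact: leq_trans msm.
have sub n u : (k.+3 <= n)%N -> V n u -> V k.+3 u.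
  by move=> h; exact: shrinking_le.
apply: (VV k); last by apply: (VS k.+1); apply: (VS k.+2); exact: Vsym.
apply: (VV k.+1); apply: (VV k.+2).
- exact: sub Va.
- by apply: Vsym; apply: sub Vw'; exact: leqW.
- exact: sub (Vv _).
- by apply: sub Vw; exact: leqW.
Qed.

End topological_group.

(** * First countable topologies on a group *)

Lemma ultra_cover (T : Type) (I : eqType) (F : set_system T) (s : seq I)
    (B : I -> set T) (A : set T) : UltraFilter F -> F A ->
  (forall x, A x -> exists2 i, i \in s & B i x) -> exists i, F (B i).
Proof.
move=> UF; elim: s A => [|i s IH] A FA AB.
  by have [x /AB[]] := filter_ex FA.
have [FB|FnB] := in_ultra_setVsetC (B i) UF; first by exists i.
apply: (IH (A `&` ~` B i)); first exact: filterI.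
move=> x [/AB[j]]; rewrite inE => /orP[/eqP -> //|js Bj _].
by exists j.
Qed.

(** The open sets are defined from left translates only.  Nothing is assumed on
    conjugates, so this is not in general a group topology. *)
Section shrinking_topology.
Variables (G : topGroupType) (V : nat -> set G).
Hypothesis sV : shrinking V.

Let V_1 n : V n 1.
Proof. by case: sV => V1 _ _ _; exact: nbhs_singleton (V1 n). Qed.

Definition shrinking_open : set_system G :=
  [set O | forall g, O g -> exists n, forall v, V n v -> O (g * v)].

Lemma shrinking_openT : shrinking_open setT.
Proof. by move=> g _; exists 0%N. Qed.

Lemma shrinking_openI : setI_closed shrinking_open.
Proof.
move=> A B oA oB g [/oA[m mA] /oB[n nB]]; exists (maxn m n) => v Vv; split.
  by apply: mA; apply: (shrinking_le sV _ Vv); rewrite leq_maxl.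
by apply: nB; apply: (shrinking_le sV _ Vv); rewrite leq_maxr.
Qed.

Lemma shrinking_open_bigcup (I : Type) (f : I -> set G) :
  (forall i, shrinking_open (f i)) -> shrinking_open (\bigcup_i f i).
Proof.
by move=> fo g [i _ /fo[n nf]]; exists n => v /nf; exists i.
Qed.

Definition shrinking_topology :=
  TopologyOn shrinking_openT shrinking_openI shrinking_open_bigcup.

Local Notation T := (retopologize shrinking_topology).

(** The sets [V n] need not be open for the new topology, but the points [h]
    such that [h V m] is in [B] for some [m] form an open set. *)
Lemma shrinking_nbhsP (g : T) (B : set T) :
  nbhs g B <-> exists n, forall v : G, V n v -> B ((g : G) * v).
Proof.
rewrite nbhsE; split=> [[D [oD Dg] DB]|[n nB]].
  by have [n nD] := oD g Dg; exists n => v /nD/DB.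
exists [set h : G | exists n, forall v : G, V n v -> B (h * v)].
  split; last by exists n.
  move=> h [m mB]; exists m.+1 => v Vv; exists m.+1 => w Vw.
  by rewrite -mulgA; apply: mB; case: sV => _ _ _; apply.
by move=> h [m mB]; rewrite -[h]mulg1; exact: mB.
Qed.

(** By total boundedness an ultrafilter [F] on [U] contains some translate
    [f_n V_n] for every [n].  Points [x_n] of the intersection of the first
    [n + 1] of these sets accumulate at some [p].  For every [n], [f_n V_n] is
    in [p V_n^4], so [F] converges to [p]. *)
Lemma shrinking_compact (U : set G) : V 0%N `<=` U -> feebly_compact_in U ->
  compact (closure (V 2%N : set T)).
Proof.
move=> VU cU; have [V1 Vsym VS VV] := sV.
rewrite compact_ultra => F UF FK.
have KU : closure (V 2%N : set T) `<=` U.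
  move=> y cly; have [|z [Vz /= Vyz]] := cly [set z | V 2%N ((y : G)^-1 * z)].
    by apply/shrinking_nbhsP; exists 2%N => v /=; rewrite mulKg.
  apply/VU/VS; rewrite -[y](mulgK ((y : G)^-1 * z)) mulVKg.
  by apply: (VV 1%N) => //; exact: Vsym.
have FU : F U by apply: filterS FK.
have /choice[f Ff] : forall n, exists g, F [set y | V n (g^-1 * y)].
  move=> n; have [s sP] := feebly_compact_totally_bounded cU (V1 n).
  exact: (@ultra_cover _ _ F s (fun g => [set y | V n (g^-1 * y)]) U).
have FI n : F [set y | U y /\ forall i, (i <= n)%N -> V i ((f i)^-1 * y)].
  elim: n => [|n IH].
    by apply: filterS (filterI FU (Ff 0%N)) => y [Uy Vy]; split=> // -[].
  apply: filterS (filterI IH (Ff n.+1)) => y [[Uy Vy] VSy]; split=> // i.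
  by rewrite leq_eqVlt => /orP[/eqP ->|]; [exact: VSy|exact: Vy].
have /choice[x xP] : forall n, exists y, U y /\
    forall i, (i <= n)%N -> V i ((f i)^-1 * y).
  by move=> n; exact: filter_ex (FI n).
have [|p clp] := cU x V _ V1; first by move=> n; case: (xP n).
have Fp : F --> (p : T).
  move=> B /shrinking_nbhsP[m mB].
  have [n [v [jn Vv /= Vpv]]] := clp _ (nbhs_translate p (V1 m.+2)) m.+2.
  apply: filterS (Ff m.+2) => y /= Vy; rewrite -[y](mulVKg p); apply: mB.
  have -> : p^-1 * y = (p^-1 * (x n * v)) * v^-1 *
      (((f m.+2)^-1 * x n)^-1 * ((f m.+2)^-1 * y)).
    by rewrite invgM invgK !mulgA mulgK mulgK mulgK.
  apply: (VV m); apply: (VV m.+1) => //; apply: Vsym.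
    exact: (shrinking_le sV jn).
  by case: (xP n) => _; apply.
exists p; split=> //; apply: closed_closure => B /Fp FB.
by have [z [? ?]] := filter_ex (filterI FK FB); exists z.
Qed.

End shrinking_topology.

(** * Open subgroups from clopen sets *)

Section open_subgroups.
Variable G : topGroupType.

Fixpoint nfold_product (A : set G) n : set G :=
  if n is m.+1 then
    [set x | exists a b, [/\ nfold_product A m a, A b & x = a * b]]
  else [set 1].

Definition uniformly_in (A C : set G) :=
  exists2 V, nbhs 1 V & forall g v, A g -> V v -> C g -> C (g * v).

(** If [A^n] is covered by [F A], then [A^(n+1)] is covered by [F A^2], where
    [A^2] lies in the totally bounded set [U] and so in finitely many translates
    of [A]. *)
Lemma nfold_product_cover (A U : set G) n :
  A 1 -> nbhs 1 A -> totally_bounded U ->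
  (forall a b, A a -> A b -> U (a * b)) ->
  exists F : seq G,
    forall x, nfold_product A n x -> exists2 f, f \in F & A (f^-1 * x).
Proof.
move=> A1 nA tU AU; have [F0 F0P] := tU A nA.
elim: n => [|n [F FP]] /=.
  by exists [:: 1] => x ->; exists 1; rewrite ?inE // invg1 mulg1.
exists [seq f * g | f <- F, g <- F0] => x [a [b [/FP[f fF Afa] Ab ->]]].
have [g gF0 Ag] := F0P _ (AU _ _ Afa Ab).
exists (f * g); first by apply/allpairsP; exists (f, g).
by rewrite invgM -!mulgA; rewrite -!mulgA in Ag.
Qed.

(** Uniformity on [f A] for [C] is uniformity on [A] for the clopen set
    [f^-1 C]; this is why the hypothesis is about all clopen sets. *)
Lemma uniformly_in_cover (A B C : set G) (F : seq G) :
  (forall D, clopen D -> uniformly_in A D) -> clopen C ->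
  (forall x, B x -> exists2 f, f \in F & A (f^-1 * x)) -> uniformly_in B C.
Proof.
move=> uA cC; elim: F B => [|f F IH] B BF.
  by exists setT => [|g v /BF[]//]; exact: filterT.
have [|V V1 VP] := IH [set x | exists2 f, f \in F & A (f^-1 * x)]; first by [].
have [W W1 WP] := uA _ (clopen_shift (@nbhs_mull G) f cC).
exists (V `&` W) => [|g v /BF[h]]; first exact: filterI.
rewrite inE => /orP[/eqP ->|hF] Ag [Vv Wv] Cg; last first.
  by apply: VP => //; exists h.
have := WP _ _ Ag Wv; rewrite /= !mulgA mulgV mul1g; exact.
Qed.

(** The sequence [V] is chosen so that three things hold for its topology.  As
    [V (n+1)] respects [C] on [A^n], the trace of [C] on the union [P] of the
    [A^n] is clopen; uniformity of [C] is only available on these sets, one at a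
    time, because [P] need not be feebly compact.  As conjugation by elements of
    [A] maps [V (n+1)] into [V n], right translations by elements of [A] are
    continuous.  As [V 0] is in [U], closures of small sets are compact. *)
Lemma feebly_compact_clopen_invariant (U C : set G) x :
  nbhs 1 U -> feebly_compact_in U -> clopen C -> C 1 -> ~ C x ->
  exists E V : set G, [/\ E 1, ~ E x, nbhs 1 V &
    forall c v, E c -> V v -> E (c * v)].
Proof.
move=> U1 cU cC C1 Cx.
have [A [nA symA AU AA]] := nbhs_sqrt U1.
have A1 : A 1 by exact: nbhs_singleton nA.
have tU := feebly_compact_totally_bounded cU.
have uA D : clopen D -> uniformly_in A D by exact: (clopen_uniform cU nA AA).
have /choice[T TP] : forall n, exists T, nbhs 1 T /\
    forall g v, nfold_product A n g -> T v -> (C g <-> C (g * v)).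
  move=> n; have [F FP] := nfold_product_cover n A1 nA tU AA.
  have [V V1 VP] := uniformly_in_cover uA cC FP.
  have [W W1 WP] := uniformly_in_cover uA (clopenC setT cC) FP.
  exists (V `&` W); split; first exact: filterI.
  move=> g v gA [Vv Wv]; split; first exact: VP.
  by move=> Cgv; apply: contrapT => /(WP g v gA Wv).
pose R n (V W : set G) := [/\ symmetric_set W, W `<=` V,
  forall a b, W a -> W b -> V (a * b), W `<=` T n &
  forall h w, A h -> W w -> V (h * w * h^-1)].
have [|V [VE V1 VR]] := @nbhs_sequence G R A nA.
  move=> n V V1; have [B [B1 symB BV BB]] := nbhs_sqrt V1.
  have [D [D1 symD DB DD]] := nbhs_sqrt B1.
  (* [h^-1] is in some [f D], with [f] in a finite set: conjugation by [h] is
     conjugation by [f^-1] followed by conjugation by a small element. *)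
  have [F FP] := tU D D1.
  have FN : nbhs 1 [set w | forall f, f \in F -> D (f^-1 * w * f)].
    elim: F {FP} => [|f F IH]; first by apply: filterS filterT.
    have := nbhs_conj f^-1 D1; rewrite invgK => fD.
    apply: filterS (filterI fD IH) => w [/= Dw Fw] g.
    by rewrite inE => /orP[/eqP ->|/Fw].
  have [W [W1 symW WF WW]] := nbhs_sqrt (filterI FN (filterI (TP n).1 V1)).
  exists W => //; split => //.
  - by move=> w /WF[_ []].
  - by move=> a b Wa Wb; have [_ []] := WW a b Wa Wb.
  - by move=> w /WF[_ []].
  - move=> h w Ah /WF[Fw _].
    have [f fF Dfh] := FP _ (AU _ (symA _ Ah)).
    have -> : h * w * h^-1 =
        (f^-1 * h^-1)^-1 * (f^-1 * w * f) * (f^-1 * h^-1).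
      by rewrite invgM !invgK !mulgA mulgK mulgK.
    apply: BB; last exact: DB.
    by apply: DD; [exact: symD|exact: Fw].
have sV : shrinking V by split=> // n; have [] := VR n.
have [_ Vsym VS VV] := sV.
have VA n : V n `<=` A by rewrite -VE; exact: shrinking_le.
pose H : PreTopologicalGroup.type := retopologize (shrinking_topology sV).
have nbhsH (g : H) (B : set H) : nbhs g B <->
    exists n, forall v : G, V n v -> B ((g : G) * v) by exact: shrinking_nbhsP.
have nV n : nbhs (1 : H) (V n : set H).
  by apply/nbhsH; exists n => v; rewrite mul1g.
have mull_cont (g y : H) (B : set H) :
    nbhs (g * y) B -> nbhs y [set z | B (g * z)].
  move=> /nbhsH[n nB]; apply/nbhsH; exists n => v /nB.
  by rewrite -mulgA.
have mul_cont1 (B : set H) : nbhs 1 B ->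
    exists2 D : set H, nbhs 1 D & forall a b, D a -> D b -> B (a * b).
  move=> /nbhsH[n nB]; exists (V n.+1 : set H); first exact: nV.
  move=> a b Va Vb; have := nB _ (VV n _ _ Va Vb).
  by rewrite mul1g.
have UR u : A u -> right_cont (u : H).
  move=> Au y B /nbhsH[n nB]; apply/nbhsH; exists n.+1 => v Vv.
  have [_ _ _ _ /(_ _ _ (symA _ Au) Vv)] := VR n; rewrite invgK => /nB /=.
  by rewrite !mulgA mulgK.
have WSK (w s : H) : V 3%N w -> V 3%N s -> closure (V 2%N : set H) (w * s^-1).
  by move=> Vw Vs; apply: subset_closure; apply: (VV 2%N) => //; exact: Vsym.
pose P : set H := [set g : G | C g /\ exists n, nfold_product A n g].
have cP : clopen P.
  apply: clopen_nbhs => g Pg; apply/nbhsH.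
    have [Cg [n gn]] := Pg; exists n.+1 => v Vv; split.
      have [_ _ _ WT _] := VR n.
      exact: ((TP n).2 g v gn (WT _ Vv)).1.
    by exists n.+1, g, v; split=> //; exact: VA Vv.
  have [[n gn]|gN] := pselect (exists n, nfold_product A n g).
    exists n.+1 => v Vv [Cgv _]; apply: Pg; split; last by exists n.
    have [_ _ _ WT _] := VR n.
    exact: ((TP n).2 g v gn (WT _ Vv)).2.
  exists 0%N => v Vv [_ [n gvn]]; apply: gN; exists n.+1, (g * v), v^-1.
  by split=> //; [apply: symA; exact: VA Vv|rewrite mulgK].
have P1 : P 1 by split=> //; exists 0%N.
have Px : ~ P x by case.
have [E [W [E1 Ex W1 EW]]] := @locally_compact_clopen_invariant
  H mull_cont mul_cont1 A
  (filterS (VA 0%N : _ `<=` (A : set H)) (nV 0%N)) symA UR _ _ _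
  (shrinking_compact (sV:=sV) (subset_trans (VA 0%N) AU) cU) (nV 3%N) (nV 3%N)
  (VA 3%N) WSK P x cP P1 Px.
exists E, W; split=> //.
have /nbhsH[n nW] := W1.
apply: filterS (V1 n) => v /nW.
by rewrite mul1g.
Qed.

Lemma open_subgroup_separates (U C : set G) x :
  nbhs 1 U -> feebly_compact_in U -> clopen C -> C 1 -> ~ C x ->
  exists2 H : set G, open_subgroup H & ~ H x.
Proof.
move=> U1 cU cC C1 Cx.
have [E [V [E1 Ex nV EV]]] := feebly_compact_clopen_invariant U1 cU cC C1 Cx.
pose H := [set h | forall c, E (c * h) <-> E c].
exists H; last first.
  by move=> /(_ 1); rewrite mul1g => -[_ /(_ E1)].
have HB a b : H a -> H b -> H (a / b).
  by move=> Ha Hb c; rewrite mulgA -(Hb (c * a / b)) mulgVK.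
have H1 : H 1 by move=> c; rewrite mulg1.
split; last by split; [rewrite inE|move=> a b; rewrite !inE; exact: HB].
have nH : nbhs 1 H.
  apply: filterS (filterI nV (nbhs_inv nV)) => v [Vv VVv] c; split.
    by move=> /EV/(_ VVv); rewrite mulgK.
  by move=> /EV; apply.
rewrite openE => h Hh; apply: filterS (nbhs_translate h nH) => y /= Hy.
have -> : y = h / (1 / (h^-1 * y)) by rewrite div1g invgK mulVKg.
by apply: (HB h) => //; exact: HB.
Qed.

End open_subgroups.

(** * Pseudocompactness implies feeble compactness *)

(** An alias that carries the left uniformity of [G]; its purpose is to show
    that [G] is completely regular. *)
Definition left_uniform (G : topGroupType) : Type := G.

Section left_uniformity.
Variable G : topGroupType.
HB.instance Definition _ := Topological.copy (left_uniform G) G.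
Local Notation T := (left_uniform G).

Definition left_entourage : set_system (T * T) :=
  filter_from (@nbhs G G 1) (fun V => [set xy : G * G | V (xy.1^-1 * xy.2)]).

Lemma left_entourage_filter : Filter left_entourage.
Proof.
apply: filter_from_filter; first by exists setT; exact: filterT.
by move=> A B A1 B1; exists (A `&` B) => //; exact: filterI.
Qed.

Lemma left_entourage_refl E : left_entourage E -> diagonal `<=` E.
Proof.
move=> [V V1 VE] [x y]; rewrite /diagonal /= => ->; apply: VE => /=.
by rewrite mulVg; exact: nbhs_singleton.
Qed.

Lemma left_entourage_inv E : left_entourage E -> left_entourage E^-1%relation.
Proof.
move=> [V V1 VE]; exists [set y | V y^-1]; first exact: nbhs_inv.
by move=> [x y] /=; rewrite invgM invgK => ?; apply: VE.
Qed.

Lemma left_entourage_split E : left_entourage E ->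
  exists2 D, left_entourage D & (D \; D `<=` E)%relation.
Proof.
move=> [V V1 VE]; have [W [W1 _ _ WW]] := nbhs_sqrt V1.
exists [set xy : G * G | W (xy.1^-1 * xy.2)]; first by exists W.
move=> [x z] [y /= Wxy Wyz]; apply: VE => /=.
by have := WW _ _ Wxy Wyz; rewrite mulgA mulgK.
Qed.

Lemma nbhs_left_entourage : nbhs = nbhs_ left_entourage.
Proof.
apply/funext => x; apply/seteqP; split=> A.
  move=> /(@nbhs_untranslate G) A1.
  exists [set xy : G * G | A (x * (xy.1^-1 * xy.2))].
    by exists [set y | A (x * y)].
  by move=> y /= /xsectionP /=; rewrite mulVKg.
move=> [E [V V1 VE] EA]; apply: filterS (nbhs_translate (x : G) V1) => y Vy.
by apply: EA; apply/xsectionP; exact: VE.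
Qed.

HB.instance Definition _ := Nbhs_isUniform_mixin.Build T
  left_entourage_filter left_entourage_refl left_entourage_inv
  left_entourage_split nbhs_left_entourage.

Lemma topGroup_completely_regular (R : realType) : completely_regular_space G.
Proof. exact: (@uniform_completely_regular R (left_uniform G)). Qed.

End left_uniformity.

(** If the open sets [O n] did not accumulate, then the sum of [n (1 - f n)],
    where [1 - f n] is a bump function that vanishes outside [O n] and has value
    1 at a point [x n] of [O n], would be locally finite.  It would be
    continuous, and at least [n] at [x n]. *)
Lemma pseudocompact_cluster (R : realType) (X : topologicalType) (U : set X)
    (O : nat -> set X) : completely_regular_space X ->
  pseudocompact R (closure U) -> (forall n, open (O n)) ->
  (forall n, O n !=set0) -> (forall n, O n `<=` U) ->
  exists p : X, forall A, nbhs p A ->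
    forall N, exists2 n, (N <= n)%N & A `&` O n !=set0.
Proof.
move=> crX pcU oO O0 OU; have /choice[x Ox] : forall n, exists y, O n y by [].
apply: contrapT => /forallNP nc.
have /choice[N NP] : forall p : X, exists N, exists2 A, nbhs p A &
    forall n y, (N <= n)%N -> A y -> ~ O n y.
  move=> p; apply: contrapT => /forallNP H; apply: (nc p) => A pA N.
  apply: contrapT => /forall2NP AO; apply: (H N); exists A => // n y Nn Ay Oy.
  by have [|] := AO n; [exact|apply; exists y].
have /choice[f fP] : forall n, exists f : X -> R,
    [/\ continuous f, f (x n) = 0%R, forall y, (f y <= 1)%R
      & forall y, ~ O n y -> f y = 1%R].
  move=> n; have := crX (x n) (~` O n).
  rewrite closedC => /(_ (oO n) (fun h => h (Ox n))).
  move=> /(uniform_separatorP (R:=R)).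
  move=> [f [cf f01 f0 f1]]; exists f; split=> //.
  - by apply: f0; exists (x n).
  - move=> y; have /f01 : range f (f y) by [].
    by rewrite /= in_itv /= => /andP[].
  - by move=> y Oy; apply: f1; exists y.
pose S M y := (\sum_(i < M) i%:R * (1 - f i y))%R.
have cS M : continuous (S M).
  elim: M => [|M IH] y.
    rewrite /S [X in continuous_at _ X](_ : _ = cst 0%R); first exact: cvg_cst.
    by apply/funext => z; rewrite big_ord0.
  rewrite /S [X in continuous_at _ X](_ : _ =
      (fun z => S M z + M%:R * (1 - f M z))%R).
    by apply: cvgD; [exact: IH|]; apply: cvgM; [exact: cvg_cst|];
      apply: cvgB; [exact: cvg_cst|]; have [+ _ _ _] := fP M; apply.
  by apply/funext => z; rewrite big_ord_recr.
have SE y K M :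
    (K <= M)%N -> (forall n, (K <= n)%N -> ~ O n y) -> S M y = S K y.
  move=> + h; elim: M => [|M IH]; first by rewrite leqn0 => /eqP ->.
  rewrite leq_eqVlt => /orP[/eqP -> //|KM]; rewrite /S big_ord_recr /=.
  have [_ _ _ ->] := fP M; last exact: h.
  by rewrite subrr mulr0 addr0 -/(S M y) IH.
(* Terms of index at least [N y] vanish near [y]: this is the whole sum. *)
pose F y := S (N y) y.
have FE y z :
    z \in [set z | forall n, (N y <= n)%N -> ~ O n z] -> F z = S (N y) z.
  move=> /set_mem zO; have [A zA AP] := NP z.
  have Oz n : (N z <= n)%N -> ~ O n z.
    by move=> h; apply: AP => //; exact: nbhs_singleton.
  rewrite /F -(SE z _ (maxn (N y) (N z)) _ Oz) ?leq_maxr//.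
  by rewrite (SE z (N y)) ?leq_maxl.
have cF : continuous F.
  move=> y; have [A yA AP] := NP y.
  have FS : {near nbhs y, S (N y) =1 F}.
    apply: filterS yA => z Az; apply/esym/FE/mem_set => n Nn; exact: AP.
  rewrite /continuous_at (FE y).
    exact: cvg_trans (near_eq_cvg FS) (cS _ y).
  by apply/mem_set => n Nn; apply: AP => //; exact: nbhs_singleton.
have Fx n : (n%:R <= F (x n))%R.
  have nN : (n < N (x n))%N.
    rewrite ltnNge; apply/negP => Nn; have [A xA /(_ n (x n) Nn)] := NP (x n).
    by move=> /(_ (nbhs_singleton xA)); apply; exact: Ox.
  rewrite /F /S (bigD1 (Ordinal nN)) //=; have [_ -> _ _] := fP n.
  rewrite subr0 mulr1 lerDl; apply: sumr_ge0 => i _.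
  by rewrite mulr_ge0// subr_ge0; have [_ _ + _] := fP i; apply.
have [|M [_ /(_ (M + 1)%R)]] := pcU (F \o set_val).
  by move=> z; apply: continuous_comp; [exact: initial_continuous|exact: cF].
rewrite ltrDl => /(_ ltr01) FM.
pose n := (Num.truncn (M + 1)%R).+1.
have clx : closure U (x n) by apply: subset_closure; apply: OU; exact: Ox.
have := FM (SigSub (mem_set clx)) I; rewrite /= => /(le_trans (ler_norm _)).
move=> /(le_trans (Fx n)); rewrite leNgt => /negP; apply.
exact: truncnS_gt.
Qed.

Lemma pseudocompact_feebly_compact (R : realType) (G : topGroupType)
    (U : set G) :
  open U -> pseudocompact R (closure U) -> feebly_compact_in U.
Proof.
move=> oU pcU x V xU V1.
pose O n := U `&` [set y | V n ((x n)^-1 * y)]°.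
have [|n|n y []//|p clp] := pseudocompact_cluster (O := O)
    (topGroup_completely_regular R (G:=G)) pcU.
- by move=> n; apply: openI => //; exact: open_interior.
- by exists (x n); split=> //; exact: nbhs_translate.
exists p => A /clp + N => /(_ N)[n Nn [y [Ay [_ /interior_subset Vy]]]].
by exists n, ((x n)^-1 * y); split=> //; rewrite mulVKg.
Qed.

(** * Zero-dimensional spaces *)

Section zero_dimensional_spaces.
Variables (R : realType) (T : topologicalType).

Lemma zerodim_space_clopen : zero_dimensional T ->
  (forall (x : T) A, nbhs x A -> exists C, [/\ clopen C, C x & C `<=` A]) ->
  zerodim_space T.
Proof.
move=> zT clT; split; last first.
  exists clopen; split=> //; split=> [C []//|x A /clT[C [cC Cx CA]]].
  by exists C.
split=> [x y xy|x B clB Bx].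
  apply: contrapT => /eqP/zT[C [cC Cx Cy]].
  by have [z []] := xy _ _ (clopen_in cC Cx) (clopen_out cC Cy).
have [C [cC Cx CB]] : exists C, [/\ clopen C, C x & C `<=` ~` B].
  by apply: clT; apply: open_nbhs_nbhs; split; rewrite ?openC.
apply/(uniform_separatorP (R:=R)); exists (\1_(~` C) : T -> R)%R; split.
- have locally_cst (f : T -> R) y :
      {near nbhs y, cst (f y) =1 f} -> f @ y --> f y.
    move=> fy; exact: cvg_trans (near_eq_cvg fy) (cvg_cst _).
  move=> y; apply: locally_cst; have [Cy|Cy] := pselect (C y).
    apply: filterS (clopen_in cC Cy) => z Cz /=.
    by rewrite !indicE !in_setC !mem_set.
  by apply: filterS (clopen_out cC Cy) => z Cz /=; rewrite !indicE !mem_set.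
- move=> _ [y _ <-]; rewrite indicE /= in_itv /=.
  by case: (_ \in _); rewrite /= ?lexx ?ler01.
- by move=> _ [y -> <-]; rewrite /= indicE in_setC mem_set.
- by move=> _ [y By <-]; rewrite /= indicE mem_set // => /CB.
Qed.
End zero_dimensional_spaces.

(** Stated for any topology on a group, to be applied both to a coarser group
    topology and to the topology of [G] when the two coincide. *)
Lemma zerodim_clopen_cosets (R : realType) (X : PreTopologicalGroup.type)
    (S : set_system X) :
  (forall K, S K -> K 1 /\ forall g, clopen [set x | K (g^-1 * x)]) ->
  (forall (x : X) A, nbhs x A -> exists2 K, S K & forall h, K h -> A (x * h)) ->
  (forall x : X, x <> 1 -> exists2 K, S K & ~ K x) -> zerodim_space X.
Proof.
move=> SK base sep; apply: (zerodim_space_clopen R) => [x y /eqP xy|x A].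
  have [|K /SK[K1 cK] Kxy] := sep (x^-1 * y).
    by move=> /(congr1 (monoid.mul x)); rewrite mulVKg mulg1 => /esym.
  by exists [set z | K (x^-1 * z)]; split=> //=; rewrite mulVg.
move=> /base[K /SK[K1 cK] KA]; exists [set z | K (x^-1 * z)].
by split=> //= [|z /KA]; rewrite ?mulVg// mulVKg.
Qed.

(** * The topology generated by the cosets of open subgroups *)

Section coset_topology.
Variable G : topGroupType.
Local Notation og := (@open_subgroup G).

Lemma open_subgroup1 H : og H -> H 1.
Proof. by move=> [_ [+ _]]; rewrite inE. Qed.

Lemma open_subgroup_div H a b : og H -> H a -> H b -> H (a / b).
Proof. by move=> [_ [_ HB]] Ha Hb; have := HB a b; rewrite !inE; apply. Qed.

Lemma open_subgroupV H a : og H -> H a -> H a^-1.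
Proof.
move=> oH Ha; rewrite -div1g; apply: open_subgroup_div => //.
exact: open_subgroup1.
Qed.

Lemma open_subgroupM H a b : og H -> H a -> H b -> H (a * b).
Proof.
move=> oH Ha Hb; rewrite -[b]invgK; apply: open_subgroup_div => //.
exact: open_subgroupV.
Qed.

Lemma open_subgroupI H K : og H -> og K -> og (H `&` K).
Proof.
move=> oH oK; split; first by apply: openI; [case: oH|case: oK].
split; first by rewrite inE; split; exact: open_subgroup1.
by move=> a b; rewrite !inE => -[? ?] [? ?]; split; exact: open_subgroup_div.
Qed.

Lemma open_subgroup_nbhs H : og H -> nbhs 1 H.
Proof.
move=> oH; apply: open_nbhs_nbhs.
by split; [case: oH|exact: open_subgroup1].
Qed.

Lemma open_subgroup_conj H g : og H -> og [set x | H (g * x * g^-1)].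
Proof.
move=> oH; split.
  rewrite openE => x Hx; rewrite /interior.
  apply: (@nbhs_mull G g x [set y | H (y / g)]).
  apply: (@nbhs_mulr G g^-1 _ H); apply: open_nbhs_nbhs.
  by split=> //; case: oH.
split; first by rewrite inE /= mulg1 mulgV; exact: open_subgroup1.
move=> a b; rewrite !inE /= => Ha Hb.
have := open_subgroup_div oH Ha Hb.
by rewrite !invgM !invgK !mulgA mulgVK.
Qed.

Definition coset_open : set_system G :=
  [set O | forall g, O g -> exists2 H, og H & forall h, H h -> O (g * h)].

Lemma open_subgroupT : og setT.
Proof. by split; [exact: openT|split=> [|? ?]; rewrite ?inE]. Qed.

Lemma coset_openT : coset_open setT.
Proof. by move=> g _; exists setT => //; exact: open_subgroupT. Qed.

Lemma coset_openI : setI_closed coset_open.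
Proof.
move=> A B oA oB g [/oA[H oH HA] /oB[K oK KB]]; exists (H `&` K).
  exact: open_subgroupI.
by move=> h [/HA ? /KB ?].
Qed.

Lemma coset_open_bigcup (I : Type) (f : I -> set G) :
  (forall i, coset_open (f i)) -> coset_open (\bigcup_i f i).
Proof. by move=> fo g [i _ /fo[H oH Hf]]; exists H => // h /Hf; exists i. Qed.

Definition coset_topology :=
  TopologyOn coset_openT coset_openI coset_open_bigcup.

Local Notation T := (retopologize coset_topology).

Lemma coset_nbhsP (g : T) (B : set T) :
  nbhs g B <-> exists2 H, og H & forall h : G, H h -> B ((g : G) * h).
Proof.
rewrite nbhsE; split=> [[D [oD Dg] DB]|[H oH HB]].
  by have [H oH HD] := oD g Dg; exists H => // h /HD/DB.
exists [set x : G | H ((g : G)^-1 * x)].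
  split; last by rewrite /= mulVg; exact: open_subgroup1.
  move=> x /= Hx; exists H => // h Hh /=.
  by rewrite mulgA; exact: open_subgroupM.
by move=> x /HB; rewrite mulVKg.
Qed.

Lemma coset_topology_coarser : coset_topology `<=` @open G.
Proof.
move=> O oO; rewrite openE => g /oO[H oH HO].
apply: filterS (nbhs_translate g (open_subgroup_nbhs oH)) => y /HO.
by rewrite mulVKg.
Qed.

(** Conjugates of open subgroups are open subgroups: [a k b h] is [a b] times
    [(b^-1 k b) h], and [(a h)^-1] is [a^-1] times [a h^-1 a^-1]. *)
Lemma coset_group_topology : group_topology coset_topology.
Proof.
split=> [[a b] A /coset_nbhsP[H oH HA]|a A /coset_nbhsP[H oH HA]].
  exists ([set x : T | H (((b : G)^-1 * ((a : G)^-1 * x)) * (b : G)^-1^-1)],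
      [set y : T | H ((b : G)^-1 * y)]) => /=.
    split; apply/coset_nbhsP.
      exists [set x | H (b^-1 * x * b^-1^-1)]; first exact: open_subgroup_conj.
      by move=> h Hh /=; rewrite mulKg.
    by exists H => // h Hh /=; rewrite mulKg.
  move=> [x y] /= [Hx Hy].
  have := HA _ (open_subgroupM oH Hx Hy).
  by rewrite invgK !mulgA !(mulgK, mulgV, mul1g).
apply/coset_nbhsP; exists [set x : G | H ((a : G) * x * (a : G)^-1)].
  exact: open_subgroup_conj.
move=> h Hh; have := HA _ (open_subgroupV oH Hh).
by rewrite /= !invgM invgK !mulgA mulVg mul1g.
Qed.

Lemma left_coset_open H g : og H -> coset_open [set x | H (g^-1 * x)].
Proof.
by move=> oH x Hx; exists H => // h Hh /=; rewrite mulgA; exact: open_subgroupM.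
Qed.

Lemma left_coset_openC H g : og H -> coset_open (~` [set x | H (g^-1 * x)]).
Proof.
move=> oH x Hx; exists H => // h Hh; apply: contra_not Hx => /= Hxh.
by have := open_subgroup_div oH Hxh Hh; rewrite mulgA mulgK.
Qed.

Lemma coset_topology_zerodim (R : realType) :
  (forall x : G, x <> 1 -> exists2 H, og H & ~ H x) -> zerodim_space T.
Proof.
apply: (@zerodim_clopen_cosets R T og) => [H oH|x A /coset_nbhsP//].
split=> [|g]; first exact: open_subgroup1.
split; first exact: left_coset_open.
by rewrite -openC; exact: left_coset_openC.
Qed.

Lemma open_cosets_zerodim (R : realType) : @open G `<=` coset_open ->
  (forall x : G, x <> 1 -> exists2 H, og H & ~ H x) -> zerodim_space G.
Proof.
move=> oG; apply: (@zerodim_clopen_cosets R G og) => [H oH|x A].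
  split=> [|g]; first exact: open_subgroup1.
  split; first by apply: coset_topology_coarser; exact: left_coset_open.
  by rewrite -openC; apply: coset_topology_coarser; exact: left_coset_openC.
rewrite nbhsE => -[D [oD Dx] DA]; have [H oH HD] := oG D oD x Dx.
by exists H => // h /HD/DA.
Qed.

End coset_topology.

(** * Strongly Vedenissoff groups *)

(** The component of 1 is trivial, so the projection to [G / G_0] is a
    homeomorphism, with inverse [repr]. *)
Lemma zerodim_vedenissoff (R : realType) (G : topGroupType) :
  zerodim_space G -> vedenissoff G.
Proof.
move=> [[hG _] [B [[_ Bx] Bc]]].
have cb (x : G) A : nbhs x A -> exists C, [/\ clopen C, C x & C `<=` A].
  by move=> /(Bx x)[C [/Bc cC Cx] CA]; exists C.
have zG : zero_dimensional G.
  move=> x y /eqP xy.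
  have [C [cC Cx Cy]] : exists C, [/\ clopen C, C x & C `<=` ~` [set y]].
    apply: cb; apply: open_nbhs_nbhs; split; last by [].
    rewrite openC; apply: accessible_closed_set1.
    exact: hausdorff_accessible.
  by exists C; split=> // /Cy; apply.
have G0 : component1 G = [set 1].
  exact: (zero_dimension_totally_disconnected zG).
have piK (g : G) : repr (\pi_(component_quotient G) g) = g.
  set y := repr _; have /eqmodP yg : y = g %[mod_eq (component1_equiv G)].
    by rewrite /y reprK.
  have /asboolP : component1_rel y g := yg.
  by rewrite G0 => /(congr1 (monoid.mul y)); rewrite mulVKg mulg1.
pose lift (S : set G) : set (component_quotient G) := [set q | S (repr q)].
have clift S : clopen S -> clopen (lift S).
  have ol D : open D -> open (lift D).
    move=> oD; rewrite /open /= /quotient_open (_ : _ @^-1` _ = D) //.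
    by apply/seteqP; split=> g; rewrite /lift /= piK.
  move=> [oS cS]; split; first exact: ol.
  by rewrite -openC; apply: (ol (~` S)); rewrite openC.
apply: (zerodim_space_clopen R).
  move=> x y xy; have [|C [cC Cx Cy]] := zG (repr x) (repr y).
    apply: contra_neq xy => /(congr1 (\pi_(component_quotient G))).
    by rewrite !reprK.
  by exists (lift C); split=> //; exact: clift.
move=> x A; rewrite nbhsE => -[D [oD Dx] DA].
have [|C [cC Cx CD]] := cb (repr x) (\pi_(component_quotient G) @^-1` D).
  by apply: open_nbhs_nbhs; split=> //; rewrite /= reprK.
exists (lift C); split=> //; first exact: clift.
by move=> y /CD /=; rewrite reprK => /DA.
Qed.

(** The identity is itself a homomorphism into a zero-dimensional group. *)
Lemma zerodim_kernel_trivial (G : topGroupType) :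
  zerodim_space G -> zerodim_kernel G = [set 1].
Proof.
move=> zG; apply/seteqP; split=> [x /(_ G idfun zG)|_ -> H f _ _].
  by apply=> y; exact: cvg_id.
by apply: (@mulgI _ (f 1)); rewrite -gmulfM !mulg1.
Qed.

Lemma open_core_trivial (G : topGroupType) :
  (forall x : G, x <> 1 -> exists2 H, open_subgroup H & ~ H x) ->
  open_core G = [set 1].
Proof.
move=> sep; apply/seteqP; split=> [x Gx|_ -> H]; last exact: open_subgroup1.
by apply: contrapT => /sep[H oH]; apply; exact: Gx.
Qed.

Lemma locally_pseudocompact_open_subgroup (R : realType) (G : topGroupType) :
  locally_pseudocompact R G -> totdisc_space G ->
  forall x : G, x <> 1 -> exists2 H, open_subgroup H & ~ H x.
Proof.
move=> [U [[oU U1] pcU]] tdG x x1.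
have [C [cC C1] Cx] : exists2 C, clopen C /\ C 1 & ~ C x.
  apply: contrapT => /forall2NP H; apply: x1.
  suff : quasi_component 1 x by rewrite tdG.
  by move=> C CC; have [|/contrapT] := H C.
have cU := pseudocompact_feebly_compact oU pcU.
apply: (open_subgroup_separates _ cU cC C1 Cx).
exact: open_nbhs_nbhs.
Qed.

Theorem theorem2 (R : realType) :
  (forall G : topGroupType,
     hausdorff_space G -> locally_pseudocompact R G -> totdisc_space G ->
     exists tau : topology_on G,
       [/\ group_topology tau, tau `<=` @open G,
           hausdorff_space (retopologize tau)
         & zerodim_space (retopologize tau)]) /\
  (forall G : topGroupType,
     hausdorff_space G -> minimal_group G -> locally_pseudocompact R G ->
     totdisc_space G ->
     zerodim_space G /\ strongly_vedenissoff G).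
Proof.
have coset_zerodim (G : topGroupType) : locally_pseudocompact R G ->
    totdisc_space G -> zerodim_space (retopologize (coset_topology G)).
  by move=> pG tG; apply: (coset_topology_zerodim R);
    exact: (locally_pseudocompact_open_subgroup pG tG).
split=> G _ => [pG tG|mG pG tG].
  have zT := coset_zerodim G pG tG.
  exists (coset_topology G); split=> //; last by case: zT => [[]].
    exact: coset_group_topology.
  exact: coset_topology_coarser.
have sep := locally_pseudocompact_open_subgroup pG tG.
have oG : @open G `<=` coset_topology G.
  apply: contrapT => oG; apply: mG; exists (coset_topology G); split.
  - exact: coset_group_topology.
  - by have [[]] := coset_zerodim G pG tG.
  - by split=> //; exact: coset_topology_coarser.
have zG := open_cosets_zerodim R oG sep.
split=> //; split; first exact: (zerodim_vedenissoff R).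
by rewrite zerodim_kernel_trivial // open_core_trivial.
Qed.
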